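(* Let $n=2p^s$, where $p$ is an odd prime and $s\in\mathbb{N}$. Let $m\in\mathbb{N}\cup\{0\}$ and integers $0=k_0<k_1<\cdots<k_m<s$, and let $S=\{p^{k_0},\ldots,p^{k_m},n-p^{k_0},\ldots,n-p^{k_m}\}\subseteq\mathbb{Z}_n$. If $\gcd(p,m+1)=1$, then the circulant graph $\mathrm{Cay}(\mathbb{Z}_n,S)$ exhibits PGFR.
   Context: The circulant graph $\mathrm{Cay}(\mathbb{Z}_n,S)$ (with $S\subseteq\mathbb{Z}_n\setminus\{0\}$, $S=-S$) has vertex set $\mathbb{Z}_n$, two distinct vertices $a,b$ being adjacent iff $b-a\in S$. For a graph $\Gamma$ with adjacency matrix $A$, the transition matrix is $H(t)=\exp(-\mathbf{i}tA)$, $t\in\mathbb{R}$, and $\mathbf{e}_v$ is the standard basis vector of vertex $v$. $\Gamma$ exhibits pretty good fractional revival (PGFR) between distinct vertices $a$ and $b$ if there is a sequence of real numbers $\{t_k\}$ with $\lim_{k\to\infty}H(t_k)\mathbf{e}_a=\alpha\mathbf{e}_a+\beta\mathbf{e}_b$ for some $\alpha,\beta\in\mathbb{C}$ with $\beta\neq0$ and $|\alpha|^2+|\beta|^2=1$; $\Gamma$ exhibits PGFR if it does so between some pair of distinct vertices. *)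

(* Defs.v *)
From HB Require Import structures.
From mathcomp Require Import all_boot all_order all_algebra.
From mathcomp Require Import complex.
From mathcomp Require Import all_classical all_reals all_analysis.

Set Implicit Arguments.
Unset Strict Implicit.
Unset Printing Implicit Defensive.

Import Order.TTheory GRing.Theory Num.Theory.
Import numFieldNormedType.Exports.

Local Open Scope classical_set_scope.
Local Open Scope ring_scope.

(* numFieldNormedType.Exports equips the sort of an abstract numClosedFieldType
   with its norm topology; this makes that topology available on R[i] itself. *)
HB.instance Definition _ (R : rcfType) := NormedModule.copy R[i] (R[i])^o.

(* The limit is taken in the normed topology of 'M[R[i]]_N (max norm over the
   complex modulus). *)
Definition expmx (R : realType) (N : nat) (M : 'M[R[i]]_N) : 'M[R[i]]_N :=
  limn (series (fun j : nat => (j`!%:R : R[i])^-1 *: M ^+ j)).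

(* A graph on N vertices is given by its adjacency relation on 'I_N. *)
Definition adjmx (R : realType) (N : nat) (e : rel 'I_N) : 'M[R[i]]_N :=
  \matrix_(a, b) (e a b)%:R.

Definition transmx (R : realType) (N : nat) (e : rel 'I_N) (t : R) :
    'M[R[i]]_N :=
  expmx (- ('i * t%:C%C) *: adjmx R e).

Definition basis_vec (R : realType) (N : nat) (v : 'I_N) : 'cV[R[i]]_N :=
  delta_mx v 0.

Definition PGFR_between (R : realType) (N : nat) (e : rel 'I_N)
    (a b : 'I_N) : Prop :=
  exists (t : nat -> R) (alpha beta : R[i]),
    [/\ beta != 0,
        `|alpha| ^+ 2 + `|beta| ^+ 2 = 1 &
        transmx e (t k) *m basis_vec R a @[k --> \oo] -->
          (alpha *: basis_vec R a + beta *: basis_vec R b : 'cV[R[i]]_N)].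

Definition PGFR (R : realType) (N : nat) (e : rel 'I_N) : Prop :=
  exists a b : 'I_N, a != b /\ PGFR_between R e a b.

(* 'Z_n is by definition the ordinal type 'I_(Zp_trunc n).+2, so for n > 1 this
   relation on 'Z_n is a graph on n vertices in the sense of adjmx. *)
Definition circulant (n : nat) (S : {set 'Z_n}) : rel 'Z_n :=
  fun a b => (a != b) && (b - a \in S).

Definition pm_powers (n p m : nat) (k : 'I_m.+1 -> nat) : {set 'Z_n} :=
  [set (p ^ k i)%N%:R | i : 'I_m.+1]%SET :|:
  [set (n - p ^ k i)%N%:R | i : 'I_m.+1]%SET.

(* Main.v *)
Require Import Defs.
From mathcomp Require Import all_boot all_order all_algebra.
From mathcomp Require Import all_reals.
From mathcomp Require Import complex ring lra zify.
From mathcomp Require Import all_classical all_analysis.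

(* Write q = p^s, n = 2q, let zeta = exp(2 pi i / n) and chi_j (v) = zeta^(jv).
   The eigenvalue on chi_j is l_j = sum_i 2 cos(2 pi j p^(k_i) / n), so
   H(t) e_0 tends to alpha e_0 + beta e_q as soon as exp(-i t l_j) tends to
   alpha + (-1)^j beta for every j.  We aim at the phases w_j = omega^((-1)^j)
   with omega = exp(2 pi i / p), that is alpha = cos(2 pi / p) and
   beta = i sin(2 pi / p) <> 0.

   By Kronecker's theorem these phases can be approximated provided every
   integer relation sum_j c_j l_j = 0 forces prod_j w_j^(c_j) = 1, i.e.
   p | sum_j (-1)^j c_j.  Now eta = - zeta satisfies eta^q = 1, and
   (-1)^j l_j = sum_i (eta^(j p^(k_i)) + eta^(- j p^(k_i))) because p is odd.
   So the relation reads f(eta) = 0 with f in Z[X] and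
   f(1) = 2 (m + 1) sum_j (-1)^j c_j.  As X^q - 1 = (X - 1)^q modulo p, this
   forces p | f(1), and p is coprime to 2 (m + 1). *)

Set Implicit Arguments.
Unset Strict Implicit.
Unset Printing Implicit Defensive.

Import Order.TTheory GRing.Theory Num.Theory.
Import numFieldNormedType.Exports.

Local Open Scope ring_scope.

(** * Integer polynomials vanishing at a p^s-th root of unity *)

(* The gcd of [f] and ['X^q - 1] is a nonconstant divisor of ['X^q - 1], which
   is [('X - 1) ^+ q] modulo [p]; so it vanishes at 1 modulo [p]. *)
Lemma dvd_horner1_of_root_unity (R : numDomainType) (p s : nat) (eta : R)
    (f : {poly int}) :
  prime p -> eta ^+ (p ^ s) = 1 -> (map_poly intr f).[eta] = 0 ->
  (p %| f.[1])%Z.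
Proof.
move=> pp eta1 f0; set q := (p ^ s)%N in eta1.
pose g : {poly int} := 'X^q - 1.
have q0 : (0 < q)%N by rewrite expn_gt0 prime_gt0.
have g0 : (map_poly intr g).[eta] = 0.
  by rewrite rmorphB rmorph1 /= map_polyXn !hornerE eta1 subrr.
have gmonic : lead_coef g = 1 by rewrite lead_coefXnsubC.
(* With the primitive part, Gauss's lemma gives factorisations of [f] and [g] by [d] inside Z[X],
   which can then be reduced modulo [p]. *)
pose d := zprimitive (gcdp f g).
have d_size : (1 < size d)%N.
  (* Otherwise a Bezout combination of [f] and [g] is a nonzero integer, yet it vanishes at
     [eta]. *)
  rewrite size_zprimitive ltnNge; apply/negP => le1.
  have /Pdiv.Idomain.Bezout_coprimepP [[u v] /=] : coprimep f g.
    rewrite coprimep_def eqn_leq le1 size_poly_gt0 gcdp_eq0 negb_and orbC.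
    by rewrite -size_poly_gt0 size_XnsubC.
  case/eqpP => -[c1 c2] /= /andP[_ c20] E.
  have : (map_poly (intr : int -> R) (c1 *: (u * f + v * g))).[eta] = 0.
    by rewrite map_polyZ rmorphD !rmorphM /= !hornerE f0 g0 !mulr0 addr0 mulr0.
  rewrite E map_polyZ rmorph1 !hornerE => /eqP.
  by rewrite intr_eq0 (negPf c20).
have /dvdpP_int [r1 fE] : gcdp f g %| f by exact: dvdp_gcdl.
have /dvdpP_int [r2 gE] : gcdp f g %| g by exact: dvdp_gcdr.
rewrite -/d in fE gE.
pose M := map_poly (intr : int -> 'F_p).
have pM : p \in [pchar {poly 'F_p}] by rewrite pchar_poly pchar_Fp.
have Mg : M g = ('X - 1%:P) ^+ q.
  rewrite /M rmorphB rmorph1 /= map_polyXn; apply: (canLR (addrK _)).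
  have := @exprDn_pchar _ ('X - 1%:P : {poly 'F_p}) 1 q.
  rewrite subrK expr1n; apply.
  by rewrite (eq_pnat _ (pcharf_eq pM)) pnatX pnat_id.
have d1 : root (M d) 1.
  (* If 1 were not a root, [M d] would be prime to the power [M g] of X - 1 that it divides, hence
     constant; but [g] is monic, so reduction keeps the size of [d]. *)
  apply: contraT; rewrite -coprimep_XsubC => cop.
  have : coprimep (M d) (M g) by rewrite Mg coprimep_expr.
  rewrite gE {2}/M rmorphM /= coprimepMr => /andP[].
  rewrite coprimepp size_map_poly_id0; first by rewrite gtn_eqF.
  move: gmonic; rewrite gE lead_coefM.
  move=> /(congr1 (fun z : int => z%:~R : 'F_p)).
  rewrite rmorphM rmorph1 /= => /eqP; apply: contraTneq => ->.
  by rewrite mul0r eq_sym oner_eq0.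
have : (f.[1])%:~R = 0 :> 'F_p.
  have -> : (f.[1])%:~R = (M f).[1].
    by rewrite -(rmorph1 (intr : int -> 'F_p)) horner_map.
  rewrite fE /M rmorphM /= hornerM.
  by move/rootP: d1 => ->; rewrite mul0r.
by move/eqP; rewrite -(dvdz_pcharf (pchar_Fp pp)).
Qed.

(** * The connection set and sums over it *)

Section PmPowers.
Variables (n p m : nat) (k : 'I_m.+1 -> nat).
Hypotheses (p_gt1 : (1 < p)%N) (k_inj : injective k).
Hypothesis k_small : forall i, (2 * p ^ k i < n)%N.

Let n_gt1 : (1 < n)%N.
Proof.
apply: leq_trans (k_small ord0).
by rewrite ltnS (leq_trans _ (leq_pmulr _ _)) // expn_gt0 ltnW.
Qed.

Let val_nat c : (c < n)%N -> (c%:R : 'Z_n) = c :> nat.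
Proof. by move=> cn; rewrite val_Zp_nat // modn_small. Qed.

Let pow_gt0 i : (0 < p ^ k i)%N.
Proof. by rewrite expn_gt0 ltnW. Qed.

Lemma pm_powers_notin0 : 0 \notin pm_powers n p k.
Proof.
have nz c : (0 < c < n)%N -> 0 <> c%:R :> 'Z_n.
  move=> /andP[c0 cn] /(congr1 (@nat_of_ord _)).
  by rewrite val_nat //= => c00; rewrite -c00 in c0.
rewrite inE negb_or; apply/andP; split; apply/imsetP => -[i _]; apply: nz.
  by have := k_small i; have := pow_gt0 i; lia.
by have := k_small i; have := pow_gt0 i; lia.
Qed.

(** As [2 * p ^ k i < n], the powers lie below n/2 and their negatives above it, so the two halves
    of the set are disjoint; injectivity of [k] rules out repetitions inside each half. *)
Lemma sum_pm_powers (V : nmodType) (f : 'Z_n -> V) :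
  \sum_(v in pm_powers n p k) f v =
  \sum_i (f (p ^ k i)%N%:R + f (- (p ^ k i)%N%:R)).
Proof.
pose A : {set 'Z_n} := [set (p ^ k i)%N%:R | i : 'I_m.+1]%SET.
pose B : {set 'Z_n} := [set (n - p ^ k i)%N%:R | i : 'I_m.+1]%SET.
have dis : [disjoint A & B].
  rewrite disjoint_subset; apply/fintype.subsetP => _ /imsetP[i _ ->].
  rewrite inE; apply/imsetP => -[j _ /(congr1 (@nat_of_ord _))].
  have := k_small i; have := k_small j; have := pow_gt0 i; have := pow_gt0 j.
  by move=> j0 i0 kj ki; rewrite !val_nat; lia.
rewrite /pm_powers (eq_bigl _ _ (fun v => finset.in_setU v A B)) bigU //=.
rewrite big_split /=; congr (_ + _).
  rewrite big_imset //= => i j _ _ /(congr1 (@nat_of_ord _)).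
  have := k_small i; have := k_small j => ki kj.
  rewrite !val_nat; try lia.
  by move/eqP; rewrite eqn_exp2l // => /eqP/k_inj.
rewrite big_imset /=.
  apply: eq_bigr => i _; congr f.
  by rewrite natrB ?pchar_Zp ?sub0r //; have := k_small i; lia.
move=> i j _ _ /(congr1 (@nat_of_ord _)).
have := k_small i; have := k_small j => ki kj.
have := pow_gt0 i; have := pow_gt0 j => i0 j0.
rewrite !val_nat; try lia.
move=> e; have /eqP : (p ^ k i = p ^ k j)%N by lia.
by rewrite eqn_exp2l // => /eqP/k_inj.
Qed.

End PmPowers.

(** * The exponential exp(i x) on the unit circle *)

Import ComplexField.Normc.

Definition cis (R : realType) (x : R) : R[i] := (cos x +i* sin x)%C.

Section Cis.
Variable R : realType.
Implicit Types x y : R.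

Lemma cisD x y : cis (x + y) = cis x * cis y.
Proof.
apply/eqP; rewrite eq_complex /= cosD sinD eqxx /=.
by apply/eqP; ring.
Qed.

Lemma cis0 : cis (0 : R) = 1.
Proof. by rewrite /cis cos0 sin0. Qed.

Lemma cis_sum (I : Type) (r : seq I) (P : pred I) (F : I -> R) :
  cis (\sum_(i <- r | P i) F i) = \prod_(i <- r | P i) cis (F i).
Proof. by apply: (big_morph (@cis R)); [exact: cisD | exact: cis0]. Qed.

Lemma cisX x n : cis (n%:R * x) = cis x ^+ n.
Proof.
elim: n => [|n IH]; first by rewrite mul0r cis0 expr0.
by rewrite -natr1 mulrDl mul1r cisD IH exprSr.
Qed.

Lemma norm_cis x : `|cis x| = 1.
Proof. by rewrite normc_def /= cos2Dsin2 sqrtr1. Qed.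

Lemma cis_neq0 x : cis x != 0.
Proof. by rewrite -normr_eq0 norm_cis oner_neq0. Qed.

Lemma cisN x : cis (- x) = (cis x)^-1.
Proof.
apply: (mulfI (cis_neq0 x)); rewrite divff ?cis_neq0 //.
by rewrite -cisD subrr cis0.
Qed.

Lemma cis_neq1 x : 0 < `|x| < 2 * pi -> cis x != 1.
Proof.
wlog x0 : x / 0 < x => [H /andP[x0 x2]|].
  have [xp|xn|x00] := ltgtP 0 x; first by apply: H; rewrite // x0.
    rewrite -[x]opprK cisN -invr1 (inj_eq invr_inj); apply: H.
      by rewrite oppr_gt0.
    by rewrite normrN x0.
  by rewrite -x00 normr0 ltxx in x0.
rewrite gtr0_norm // => /andP[_ x2].
apply/eqP => /eqP; rewrite eq_complex /= => /andP[/eqP c1 _].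
(* Half angles: cos x = 1 - 2 sin(x/2)^2, and x/2 lies strictly between 0 and pi. *)
have s0 : 0 < sin (x / 2).
  by apply: sin_gt0_pi; rewrite divr_gt0 //= ltr_pdivrMr // mulrC.
have := c1; have -> : x = (x / 2) *+ 2 by rewrite -mulr_natr mulfVK.
rewrite cos_mulr2n cos2sin2 => h.
have : sin (x / 2) ^+ 2 = 0 by lra.
by move/eqP; rewrite sqrf_eq0 (gt_eqF s0).
Qed.

End Cis.

(** * Kronecker's simultaneous approximation theorem *)

(* Averaging over [t = 0, h, ..., (M - 1) h] with [h] so small that the
   numbers [cis (h * mu g)] with [mu g <> 0] stay away from 1. *)
Lemma trig_constant_coef_le (R : realType) (I : finType) (mu : I -> R)
    (a : I -> R[i]) (B : R) :
  (forall t, `|\sum_g a g * cis (t * mu g)| <= B%:C%C) ->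
  `|\sum_(g | mu g == 0) a g| <= B%:C%C.
Proof.
move=> leB.
(* [S] exceeds every |mu g|, which keeps the angles [h * mu g] within the range of [cis_neq1]. *)
pose S := 1 + \sum_g `|mu g|.
have S0 : 0 < S by rewrite ltr_pwDl // sumr_ge0.
pose h := pi / S.
have h0 : 0 < h by rewrite divr_gt0 // pi_gt0.
pose z g := cis (h * mu g).
have z1 g : mu g != 0 -> z g != 1.
  move=> mug; apply: cis_neq1; rewrite normr_gt0 (mulf_neq0 (lt0r_neq0 h0)) //=.
  rewrite normrM (gtr0_norm h0) /h -mulrA mulrC ltr_pM2r ?pi_gt0 //.
  rewrite mulrC ltr_pdivrMr //.
  have : `|mu g| <= \sum_g `|mu g| by rewrite (bigD1 g) //= lerDl sumr_ge0.
  by rewrite /S => ?; have := S0; rewrite /S; lra.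
set A := \sum_(g | mu g == 0) a g.
pose C := \sum_(g | mu g != 0) `|a g| * (2 / `|z g - 1|).
(* A geometric sum of ratio [z g != 1] has modulus at most 2 / |z g - 1|, so the error [C] does not
   grow with [M]. *)
have ineq (M : nat) : M%:R * `|A| <= M%:R * B%:C%C + C.
  have sumE : \sum_(j < M) \sum_g a g * cis ((j%:R * h) * mu g) =
      M%:R * A + \sum_(g | mu g != 0) a g * \sum_(j < M) z g ^+ j.
    rewrite exchange_big /= (bigID (fun g => mu g == 0)) /=; congr (_ + _).
      rewrite /A mulr_sumr; apply: eq_bigr => g /eqP ->.
      under eq_bigr => j _ do rewrite mulr0 cis0 mulr1.
      by rewrite sumr_const card_ord mulr_natl.
    apply: eq_bigr => g _; rewrite mulr_sumr; apply: eq_bigr => j _.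
    by rewrite -mulrA cisX.
  have -> : M%:R * `|A| = `|M%:R * A| by rewrite normrM normr_nat.
  rewrite -[M%:R * A](addrK (\sum_(g | mu g != 0) a g * \sum_(j < M) z g ^+ j)).
  rewrite -sumE; apply: (le_trans (ler_normB _ _)); apply: lerD.
    apply: (le_trans (ler_norm_sum _ _ _)).
    apply: (le_trans (ler_sum _ (fun j _ => leB _))).
    by rewrite sumr_const card_ord mulr_natl.
  apply: (le_trans (ler_norm_sum _ _ _)); apply: ler_sum => g mug.
  rewrite normrM ler_wpM2l // ler_pdivlMr ?normr_gt0 ?subr_eq0 ?z1 //.
  rewrite -normrM mulrC -subrX1; apply: (le_trans (ler_normB _ _)).
  by rewrite normrX norm_cis expr1n normr1.
have [c cE] : exists c : R, C = c%:C%C.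
  exists (\sum_(g | mu g != 0) normc (a g) * (2 / normc (z g - 1))).
  rewrite /C rmorph_sum; apply: eq_bigr => g _.
  by rewrite rmorphM fmorph_div rmorph_nat.
have nE (x : R[i]) : `|x| = (normc x)%:C%C by [].
rewrite nE lecR leNgt; apply/negP => ltBA.
have AB0 : 0 < normc A - B by rewrite subr_gt0.
(* This many samples exceed c / (|A| - B), against M (|A| - B) <= c. *)
have := ineq (Num.truncn (c / (normc A - B))).+1.
rewrite cE nE -!(rmorph_nat (real_complex R)) -!rmorphM -rmorphD lecR.
have := truncnS_gt (c / (normc A - B)); rewrite ltr_pdivrMr // => lt1 le1.
by lra.
Qed.

(** At k = M (N + 1), Bernoulli's inequality bounds the right side below by (M x)^(N + 1), of degree
    N + 1 in [M], whereas the left side is at most (M (N + 2))^N. *)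
Lemma polynomial_lt_exponential (R : archiRealFieldType) (x : R) N :
  0 < x -> exists k, k.+1%:R ^+ N < (1 + x) ^+ k.
Proof.
move=> x0.
have bernoulli M : 1 + M%:R * x <= (1 + x) ^+ M.
  elim: M => [|M IH]; first by rewrite mul0r addr0 expr0.
  have h : 0 <= M%:R * x by rewrite mulr_ge0 // ltW.
  rewrite exprSr; apply: le_trans (ler_wpM2r _ IH); last lra.
  by rewrite -natr1; nra.
pose M := (Num.truncn (N.+2%:R ^+ N / x ^+ N.+1)).+1.
exists (M * N.+1)%N.
have MP : N.+2%:R ^+ N < M%:R * x ^+ N.+1.
  by rewrite -ltr_pdivrMr ?exprn_gt0 //; exact: truncnS_gt.
have M0 : 0 < M%:R :> R by rewrite ltr0n.
apply: (@le_lt_trans _ _ ((M * N.+2)%:R ^+ N)).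
  by rewrite lerXn2r ?nnegrE ?ler0n // ler_nat [leqRHS]mulnS -add1n leq_add2r.
apply: (@lt_le_trans _ _ ((M%:R * x) ^+ N.+1)).
  rewrite natrM !exprMn exprS -mulrA [M%:R * _]mulrCA.
  by rewrite ltr_pM2l // exprn_gt0.
rewrite exprM lerXn2r ?nnegrE //.
- by rewrite mulr_ge0 // ltW.
- by rewrite exprn_ge0 // addr_ge0 // ltW.
- by apply: le_trans (bernoulli M); rewrite lerDr.
Qed.

(* Expanding the k-th power of the sum gives [#|T| ^ k] unimodular terms but at
   most [k.+1 ^ #|T|] frequencies, and terms of equal frequency are equal. *)
Lemma pigeonhole_power_le (R : realType) (T : finType) (theta : T -> R)
    (w : T -> R[i]) (B : R) :
  (forall x, `|w x| = 1) ->
  (forall k (f g : 'I_k -> T), \sum_i theta (f i) = \sum_i theta (g i) ->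
     \prod_i w (f i) = \prod_i w (g i)) ->
  (forall t, `|\sum_x w x * cis (t * theta x)| <= B%:C%C) ->
  forall k, #|T|%:R ^+ k <= k.+1%:R ^+ #|T| * B ^+ k.
Proof.
move=> w1 wP leB k.
have B0 : 0 <= B by have := le_trans (normr_ge0 _) (leB 0); rewrite (lecR 0).
pose mu (g : {ffun 'I_k -> T}) := \sum_i theta (g i).
pose a (g : {ffun 'I_k -> T}) := \prod_i w (g i).
have na g : `|a g| = 1 by rewrite normr_prod big1.
(* Shifting all frequencies by [mu g0] makes the terms of frequency [mu g0] in the expanded power
   the constant coefficient; they all equal [a g0], so nothing cancels. *)
have freq_le (g0 : {ffun 'I_k -> T}) : #|[pred g | mu g == mu g0]|%:R <= B ^+ k.
  have := @trig_constant_coef_le R _ (fun g => mu g - mu g0) a (B ^+ k).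
  have -> : \sum_(g | mu g - mu g0 == 0) a g =
      #|[pred g | mu g == mu g0]|%:R * a g0.
    rewrite -sum1_card natr_sum mulr_suml; apply: eq_big => g.
      by rewrite subr_eq0.
    by rewrite subr_eq0 mul1r => /eqP; exact: wP.
  rewrite normrM na mulr1 normr_nat -(rmorph_nat (real_complex R)) lecR; apply.
  move=> t.
  have -> : \sum_g a g * cis (t * (mu g - mu g0)) =
      (\sum_x w x * cis (t * theta x)) ^+ k * cis (- (t * mu g0)).
    have -> : forall y : R[i], y ^+ k = \prod_(i < k) y.
      by move=> y; rewrite prodr_const card_ord.
    rewrite bigA_distr_bigA /= mulr_suml; apply: eq_bigr => g _.
    rewrite mulrBr cisD mulrA; congr (_ * _).
    by rewrite big_split /= -cis_sum -mulr_sumr.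
  by rewrite normrM norm_cis mulr1 normrX rmorphXn lerXn2r ?nnegrE // (lecR 0).
(* The occurrence counts of the word [g] determine its frequency. Each count is at most [k], so
   [inord] loses nothing. *)
pose c (g : {ffun 'I_k -> T}) : {ffun T -> 'I_k.+1} :=
  [ffun x => inord #|[pred i | g i == x]|].
have mu_c g g0 : c g = c g0 -> mu g = mu g0.
  have muE f : mu f = \sum_x (c f x)%:R * theta x.
    rewrite /mu (partition_big f predT) //=; apply: eq_bigr => x _.
    rewrite ffunE inordK; last first.
      by rewrite ltnS (leq_trans (max_card _)) // card_ord.
    rewrite (eq_bigr (fun=> theta x)) => [|i /eqP -> //].
    by rewrite sumr_const mulr_natl.
  by rewrite !muE => ->.
have -> : #|T|%:R ^+ k = \sum_d #|[pred g | c g == d]|%:R :> R.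
  rewrite -natr_sum -natrX; congr (_%:R).
  rewrite -{1}(card_ord k) -card_ffun -sum1_card (partition_big c predT) //=.
  by apply: eq_bigr => d _; rewrite sum1_card.
have -> : k.+1%:R ^+ #|T| * B ^+ k = \sum_(d : {ffun T -> 'I_k.+1}) B ^+ k.
  by rewrite sumr_const card_ffun card_ord -natrX mulr_natl.
apply: ler_sum => d _.
have [g0 /eqP dE|none] := pickP [pred g | c g == d]; last first.
  by rewrite (eq_card0 none) exprn_ge0.
apply: (le_trans _ (freq_le g0)); rewrite ler_nat; apply: subset_leq_card.
by apply/fintype.subsetP => g; rewrite !inE -dE => /eqP/mu_c ->.
Qed.

(* Bohr's argument: if [F t = \sum_x (w x)^-1 * cis (t * theta x)] stayed away
   from its maximal modulus [#|T|], then [pigeonhole_power_le] would contradict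
   [polynomial_lt_exponential].  The point [x0] fixes the global phase. *)
Lemma kronecker (R : realType) (T : finType) (theta : T -> R) (w : T -> R[i])
    (x0 : T) :
  theta x0 = 0 -> w x0 = 1 -> (forall x, `|w x| = 1) ->
  (forall k (f g : 'I_k -> T), \sum_i theta (f i) = \sum_i theta (g i) ->
     \prod_i w (f i) = \prod_i w (g i)) ->
  forall e : R, 0 < e ->
  exists t, forall x, `|cis (t * theta x) - w x| < e%:C%C.
Proof.
move=> th0 w0 w1 wP e e0.
apply: contrapT => /forallNP far.
have {}far t : exists x, e%:C%C <= `|cis (t * theta x) - w x|.
  have /existsNP[x /negP xP] := far t.
  by exists x; move: xP; rewrite [`|_|]normc_def ltcR -leNgt lecR.
have wn x : w x != 0 by rewrite -normr_eq0 w1 oner_neq0.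
pose u t x := (w x)^-1 * cis (t * theta x).
have u1 t x : `|u t x| = 1 by rewrite normrM normfV w1 invr1 mul1r norm_cis.
have ux0 t : u t x0 = 1 by rewrite /u th0 w0 mulr0 cis0 invr1 mulr1.
have {}far t : exists2 x, x != x0 & e%:C%C <= `|u t x - 1|.
  have [x xP] := far t; exists x.
    apply: contraTneq xP => ->; rewrite th0 mulr0 cis0 w0 subrr normr0.
    by rewrite (lecR _ 0) -ltNge.
  have -> : u t x - 1 = (w x)^-1 * (cis (t * theta x) - w x).
    by rewrite mulrBr mulVf.
  by rewrite normrM normfV w1 invr1 mul1r.
have e2 : e <= 2.
  have [x _ xP] := far 0; rewrite -lecR; apply: (le_trans xP).
  by apply: (le_trans (ler_normB _ _)); rewrite u1 normr1 rmorph_nat.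
(* If |u| = 1 and |u - 1| >= e, then |1 + u|^2 = 4 - |u - 1|^2 <= 4 - e^2 <= (2 - e^2/4)^2. The
   terms at [x0] and at the bad index thus lose e^2/4 against the trivial bound #|T|. *)
pose B := #|T|%:R - e ^+ 2 / 4.
have T2 : (2 <= #|T|)%N.
  have [x xx0 _] := far 0.
  by rewrite (cardD1 x0) (cardD1 x) !inE xx0.
have T2R : 2 <= #|T|%:R :> R by rewrite (ler_nat _ 2).
have d0 : 0 < e ^+ 2 / 4 by rewrite divr_gt0 // exprn_gt0.
have B0 : 0 < B by rewrite /B; nra.
have leB t : `|\sum_x (w x)^-1 * cis (t * theta x)| <= B%:C%C.
  have [x xx0 xP] := far t.
  rewrite (bigD1 x0) //= (bigD1 x) //= -/(u t x0) -/(u t x) ux0 addrA.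
  apply: (le_trans (ler_normD _ _)).
  have -> : B = (2 - e ^+ 2 / 4) + (#|T|.-2)%:R.
    by rewrite /B -{1}(subnK T2) natrD subn2; ring.
  rewrite rmorphD; apply: lerD.
    have := u1 t x; case: (u t x) xP => y z.
    rewrite !normc_def /= lecR => h1 [] h2.
    have {}h2 : y ^+ 2 + z ^+ 2 = 1.
      by rewrite -[LHS]sqr_sqrtr ?h2 ?expr1n // addr_ge0 ?sqr_ge0.
    move: h1; set X := (X in e <= Num.sqrt X) => h1.
    have X0 : 0 <= X by rewrite addr_ge0 ?sqr_ge0.
    have {}h1 : e ^+ 2 <= X.
      by rewrite -(sqr_sqrtr X0) lerXn2r ?nnegrE ?sqrtr_ge0 ?(ltW e0).
    have XE : X = (y - 1) ^+ 2 + z ^+ 2 by rewrite /X; ring.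
    have d2 : 0 <= 2 - e ^+ 2 / 4 by nra.
    rewrite lecR -[leRHS]ger0_norm // -sqrtr_sqr ler_sqrt ?sqr_ge0 //.
    by move: h1; rewrite XE; nra.
  apply: (le_trans (ler_norm_sum _ _ _)).
  rewrite (eq_bigr (fun=> 1)) => [|y _]; last exact: u1.
  rewrite sumr_const rmorph_nat ler_nat.
  rewrite [in leqRHS](cardD1 x0) [in leqRHS](cardD1 x) !inE xx0 !add1n /=.
  apply: subset_leq_card.
  by apply/fintype.subsetP => y; rewrite !inE andbT andbC.
have BT : 0 < #|T|%:R / B - 1.
  by rewrite subr_gt0 ltr_pdivlMr // mul1r /B ltrBlDr ltrDl.
have [k] := polynomial_lt_exponential #|T| BT.
rewrite addrC subrK ltNge => /negP; apply.
rewrite expr_div_n ler_pdivrMr ?exprn_gt0 //.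
apply: (@pigeonhole_power_le _ _ theta (fun x => (w x)^-1)) => //.
  by move=> x; rewrite normfV w1 invr1.
by move=> l f g /wP fg; rewrite !prodfV fg.
Qed.

(** Turns a congruence modulo [p] between exponents into an equality of powers of exp(2 pi i /
    p). *)
Lemma cis_dvd (R : realType) (p : nat) (z : int) : (0 < p)%N -> (p %| z)%Z ->
  cis (z%:~R * (2 * pi / p%:R)) = 1 :> R[i].
Proof.
move=> p0 /dvdzP[y ->].
have -> : (y * p)%:~R * (2 * pi / p%:R) = y%:~R * (2 * pi) :> R.
  by rewrite intrM; field; rewrite pnatr_eq0 -lt0n.
have cis2pi : cis (2 * pi) = 1 :> R[i].
  by rewrite /cis [2 * pi]mulr_natl cos2pi sin2pi.
have cis_nat k : cis (k%:R * (2 * pi)) = 1 :> R[i].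
  by rewrite cisX cis2pi expr1n.
case: y => y; first exact: cis_nat.
by rewrite NegzE rmorphN mulNr cisN cis_nat invr1.
Qed.

(** * Complex limits and the exponential of a diagonalised matrix *)

Section MatrixExponential.
Local Open Scope classical_set_scope.

(** The order of [R[i]] compares only numbers with equal imaginary parts, so the radii in limits
    over [R[i]] are real. *)
Lemma gt0_complex (R : realType) (e : R[i]) :
  0 < e -> exists e1 : R, e = e1%:C%C.
Proof.
by case: e => x y; rewrite ltcE /= => /andP[/eqP -> _]; exists x.
Qed.

Lemma cvg_complex (R : realType) (u v : nat -> R) (a b : R) :
  u @ \oo --> a -> v @ \oo --> b ->
  (u k +i* v k)%C @[k --> \oo] --> (a +i* b)%C.
Proof.
move=> ua vb; apply/cvgrPdist_lt => e e0.
have [e1 eE] := gt0_complex e0; move: e0; rewrite eE (ltcR 0) => e0.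
have e20 : 0 < e1 / 2 by rewrite divr_gt0.
move/cvgrPdist_lt : ua => /(_ _ e20) ua.
move/cvgrPdist_lt : vb => /(_ _ e20) vb.
near=> k.
have -> : ((a +i* b) - (u k +i* v k) = (a - u k)%:C + 'i * (b - v k)%:C)%C.
  by apply/eqP; rewrite eq_complex /=; apply/andP; split; apply/eqP; ring.
apply: (le_lt_trans (ler_normD _ _)).
rewrite normrM !normc_def /= !expr0n /= !addr0 add0r expr1n sqrtr1 mul1r.
rewrite !sqrtr_sqr -rmorphD ltcR (splitr e1) ltrD //.
  by near: k.
by near: k.
Unshelve. all: by end_near. Qed.

(** Even powers of i x give the cosine series and odd powers i times the sine series, already for
    partial sums. *)
Lemma cvg_series_cis (R : realType) (x : R) :
  series (fun j => (j`!%:R : R[i])^-1 * ('i%C * x%:C%C) ^+ j) @ \oo --> cis x.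
Proof.
have := @cvg_complex R (series (cos_coeff x)) (series (sin_coeff x))
  (cos x) (sin x).
have -> : (fun k => (series (cos_coeff x) k +i* series (sin_coeff x) k)%C) =
  series (fun j => (j`!%:R : R[i])^-1 * ('i%C * x%:C%C) ^+ j).
  apply/funext => n; rewrite /series /=.
  elim: n => [|n IH]; first by rewrite !big_nil.
  rewrite !big_nat_recr //= -IH.
  rewrite exprMn -rmorphXn /= /cos_coeff /sin_coeff /=.
  have -> : (n`!%:R : R[i])^-1 = ((n`!%:R)^-1)%:C%C.
    by rewrite fmorphV /= rmorph_nat.
  rewrite -exprnP.
  (* The factor [(odd n)%:R] is 0 at n = 0, where the predecessor is truncated. *)
  have -> : ('i%C ^+ n = ((~~ odd n)%:R * (-1) ^+ n./2)%:C%C +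
      'i%C * ((odd n)%:R * (-1) ^+ n.-1./2)%:C%C :> R[i]).
    rewrite -{1}(odd_double_half n) exprD -mul2n exprM sqr_i.
    rewrite !rmorphM !rmorphXn !rmorphN1 !rmorph_nat.
    case: (boolP (odd n)) => on /=; last by rewrite mul0r mulr0 addr0.
    rewrite mul0r add0r !mul1r expr1; congr (_ * _ ^+ _).
    by rewrite -[X in X.-1](odd_double_half n) on add1n /= doubleK.
  by apply/eqP; rewrite eq_complex /=; apply/andP; split; apply/eqP; ring.
apply.
  rewrite unlock; exact: is_cvg_series_cos_coeff.
rewrite unlock; exact: is_cvg_series_sin_coeff.
Qed.

Lemma cvg_mx (K : numFieldType) m n (F : nat -> 'M[K]_(m, n))
    (M : 'M[K]_(m, n)) :
  (forall i j, F k i j @[k --> \oo] --> M i j) -> F @ \oo --> M.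
Proof.
move=> FM; apply/cvg_ballP => e e0.
have : \forall k \near \oo, forall i j, ball (M i j) e (F k i j).
  apply: filter_forall => i; apply: filter_forall => j.
  by move/cvg_ballP: (FM i j); apply.
by apply: filterS => k FMe; split.
Qed.

(** Combinations of complete orthogonal idempotents multiply coefficientwise, so each entry of the
    exponential series splits into the scalar series of exp(i c_j). *)
Lemma expmx_spec (R : realType) N (I : finType) (c : I -> R)
    (E : I -> 'M[R[i]]_N.+1) :
  (forall j l, E j *m E l = if j == l then E j else 0) ->
  \sum_j E j = 1%:M ->
  expmx (\sum_j ('i * (c j)%:C)%C *: E j) = \sum_j cis (c j) *: E j.
Proof.
move=> EE E1.
have Epow k : (\sum_j ('i * (c j)%:C)%C *: E j) ^+ k =
    \sum_j ('i * (c j)%:C)%C ^+ k *: E j.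
  elim: k => [|k IH].
    rewrite expr0 -[1]/(1%:M) -E1.
    by apply: eq_bigr => j _; rewrite expr0 scale1r.
  rewrite exprS IH -[_ * _]/(_ *m _) mulmx_suml; apply: eq_bigr => j _.
  rewrite mulmx_sumr (bigD1 j) //= big1 ?addr0.
    by rewrite -scalemxAl -scalemxAr EE eqxx scalerA -exprS.
  by move=> l /negPf lj; rewrite -scalemxAl -scalemxAr EE eq_sym lj !scaler0.
rewrite /expmx; apply: cvg_lim; first exact: norm_hausdorff.
apply: cvg_mx => a b.
pose G j k :=
  series (fun l => (l`!%:R : R[i])^-1 * ('i%C * (c j)%:C%C) ^+ l) k * E j a b.
have -> : (fun k => series (fun j => (j`!%:R : R[i])^-1 *:
    (\sum_l ('i * (c l)%:C)%C *: E l) ^+ j) k a b) = fun k => \sum_j G j k.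
  apply/funext => k; rewrite /series /= summxE.
  rewrite /G /series /=; under [RHS]eq_bigr => j _ do rewrite mulr_suml.
  rewrite exchange_big /=; apply: eq_bigr => l _.
  rewrite Epow scaler_sumr summxE; apply: eq_bigr => j _.
  by rewrite !mxE mulrA.
rewrite summxE.
have -> : \sum_j (cis (c j) *: E j) a b = \sum_j cis (c j) * E j a b.
  by apply: eq_bigr => j _; rewrite mxE.
apply: cvg_big => [|j _]; first exact: add_continuous.
by apply: cvgMl; exact: cvg_series_cis.
Qed.

End MatrixExponential.

(** * Characters of Z_n and the spectrum of circulant graphs *)

Section Characters.
Local Open Scope classical_set_scope.

Variables (R : realType) (n : nat).
Notation N := (Zp_trunc n).+2.
Implicit Types i j u v : 'Z_n.

Definition zeta : R[i] := cis (2 * pi / N%:R).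

(** The exponent is a product of representatives in [nat]; only its class modulo [N] matters, since
    [zeta ^+ N = 1]. *)
Definition chi j v : R[i] := zeta ^+ (j * v)%N.

(** The orthogonal projector v v* / N onto the line of the character v = (chi j a)_a. *)
Definition chi_proj j : 'M[R[i]]_N := \matrix_(a, b) (chi j (a - b) / N%:R).

Lemma zetaN : zeta ^+ N = 1.
Proof.
rewrite /zeta -cisX mulrC divfK ?pnatr_eq0 //.
by rewrite /cis [2 * pi]mulr_natl cos2pi sin2pi.
Qed.

Lemma chiC j v : chi j v = chi v j.
Proof. by rewrite /chi mulnC. Qed.

Lemma chi0 j : chi j 0 = 1.
Proof. by rewrite /chi muln0. Qed.

Lemma chiDr j u v : chi j (u + v) = chi j u * chi j v.
Proof.
by rewrite /chi -exprD -mulnDr -(expr_mod _ zetaN) /= modnMmr expr_mod ?zetaN.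
Qed.

Lemma chiDl i j v : chi (i + j) v = chi i v * chi j v.
Proof. by rewrite chiC chiDr !(chiC v). Qed.

Lemma chi_neq0 j v : chi j v != 0.
Proof. exact/expf_neq0/cis_neq0. Qed.

Lemma chiNr j v : chi j (- v) = (chi j v)^-1.
Proof.
by apply: (mulIf (chi_neq0 j v)); rewrite -chiDr addNr chi0 mulVf ?chi_neq0.
Qed.

Lemma chi_nat j c : chi j c%:R = zeta ^+ (j * c)%N.
Proof.
by rewrite /chi Zp_nat /= -(expr_mod _ zetaN) modnMmr expr_mod ?zetaN.
Qed.

Lemma sum_chi v : \sum_j chi j v = if v == 0 then N%:R else 0.
Proof.
case: eqVneq => [->|v0].
  under eq_bigr => j _ do rewrite chi0.
  by rewrite sumr_const card_ord.
have chi1 : chi 1 v != 1.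
  rewrite /chi mul1n /zeta -cisX; apply: cis_neq1.
  have vN : (v%:R : R) < N%:R by rewrite ltr_nat ltn_ord.
  have vp : 0 < (v%:R : R).
    by rewrite ltr0n lt0n; apply: contra v0 => /eqP v0; apply/eqP/val_inj.
  have N0 : 0 < N%:R :> R by rewrite ltr0n.
  have pi0 := pi_gt0 R.
  rewrite gtr0_norm; last by rewrite mulr_gt0 // divr_gt0 // mulr_gt0.
  rewrite mulr_gt0 ?divr_gt0 ?mulr_gt0 //= mulrA ltr_pdivrMr //.
  by rewrite mulrC ltr_pM2l // mulr_gt0.
(* Shifting [j] by 1 multiplies the sum by [chi 1 v], which is not 1, so the sum is 0. *)
apply/eqP; move: chi1; rewrite -subr_eq0 => /mulfI/inj_eq <-; rewrite mulr0.
rewrite mulrBl mul1r subr_eq0 mulr_sumr eq_sym [eqbLHS](reindex_inj (addrI 1)).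
by apply/eqP; apply: eq_bigr => j _; rewrite chiDl.
Qed.

Lemma chi_proj_mul j l :
  chi_proj j *m chi_proj l = if j == l then chi_proj j else 0.
Proof.
have N0 : N%:R != 0 :> R[i] by rewrite pnatr_eq0.
apply/matrixP => a b; rewrite !mxE.
have -> : \sum_c chi_proj j a c * chi_proj l c b =
    chi j a * chi l (- b) / N%:R / N%:R * \sum_c chi c (l - j).
  rewrite mulr_sumr; apply: eq_bigr => c _; rewrite !mxE !chiDr !chiNr.
  by rewrite [chi c l]chiC [chi c j]chiC; ring.
rewrite sum_chi subr_eq0 [l == j]eq_sym; case: eqVneq => [->|_].
  by rewrite mulfVK // !mxE chiDr.
by rewrite mulr0 mxE.
Qed.

(** Spectral decomposition of the translation by [h]; at h = 0 it is the resolution of the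
    identity. *)
Lemma sum_chi_proj h :
  \sum_j chi j h *: chi_proj j = \matrix_(a, b) (b == h + a)%:R.
Proof.
have N0 : N%:R != 0 :> R[i] by rewrite pnatr_eq0.
apply/matrixP => a b; rewrite summxE mxE.
under eq_bigr => j _ do rewrite !mxE mulrA -chiDr.
rewrite -mulr_suml sum_chi addrA subr_eq0 eq_sym.
by case: eqP; rewrite ?divff ?mul0r.
Qed.

(** The adjacency matrix is the sum of the translations by the elements of [S], all diagonal in the
    characters; [0 \notin S] matches the absence of loops. *)
Lemma adjmx_circulant (S : {set 'Z_n}) : 0 \notin S ->
  adjmx R (circulant S) = \sum_j (\sum_(v in S) chi j v) *: chi_proj j.
Proof.
move=> S0; under eq_bigr => j _ do rewrite scaler_suml.
rewrite exchange_big /=.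
under eq_bigr => v _ do rewrite sum_chi_proj.
apply/matrixP => a b; rewrite summxE mxE /circulant.
under eq_bigr => v _ do rewrite mxE.
have -> : (a != b) && (b - a \in S) = (b - a \in S).
  by case: (eqVneq a b) => // ->; rewrite subrr (negPf S0).
have [bS|bS] := boolP (b - a \in S).
  rewrite (bigD1 (b - a)) //= subrK eqxx big1 ?addr0 // => v /andP[_ vb].
  by rewrite -subr_eq eq_sym (negPf vb).
rewrite big1 // => v vS; case: eqP => // bv.
by rewrite bv addrK vS in bS.
Qed.

Lemma transmx_circulant (S : {set 'Z_n}) (l : 'Z_n -> R) t : 0 \notin S ->
  (forall j, \sum_(v in S) chi j v = (l j)%:C%C) ->
  transmx (circulant S) t = \sum_j cis (- t * l j) *: chi_proj j.
Proof.
move=> S0 lE.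
have AE : - ('i * t%:C%C) *: adjmx R (circulant S) =
    \sum_j ('i * (- t * l j)%:C)%C *: chi_proj j.
  rewrite adjmx_circulant // scaler_sumr; apply: eq_bigr => j _.
  by rewrite scalerA lE -complexiE rmorphM rmorphN mulNr mulNr mulrN mulrA.
rewrite /transmx AE expmx_spec //; first exact: chi_proj_mul.
have := sum_chi_proj 0; under eq_bigr => j _ do rewrite chi0 scale1r.
by move=> ->; apply/matrixP => a b; rewrite !mxE add0r eq_sym.
Qed.

(** The evolved state and the target both expand along the vectors [chi_proj j] e_0, the target with
    coefficients [w j], so convergence of the phases suffices. *)
Lemma PGFR_between_circulant (S : {set 'Z_n}) (l : 'Z_n -> R) (w : 'Z_n -> R[i])
    (h : 'Z_n) (alpha beta : R[i]) : 0 \notin S ->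
  (forall j, \sum_(v in S) chi j v = (l j)%:C%C) ->
  (forall j, w j = alpha + beta * chi j h) ->
  beta != 0 -> `|alpha| ^+ 2 + `|beta| ^+ 2 = 1 ->
  (forall e : R, 0 < e -> exists t, forall j, `|cis (t * l j) - w j| < e%:C%C) ->
  PGFR_between R (circulant S) 0 (- h).
Proof.
move=> S0 lE wE b0 ab1 approx.
have /choice [t tP] (k : nat) :
    exists t, forall j, `|cis (t * l j) - w j| < (k.+1%:R^-1)%:C%C.
  by apply: approx; rewrite invr_gt0 ltr0n.
(* [transmx] at time t carries the phases [cis (- t * l j)], hence the opposite times. *)
exists (fun k => - t k), alpha, beta; split=> //.
have cvg_w j : cis (t k * l j) @[k --> \oo] --> w j.
  apply/cvgrPdist_lt => e e0.
  have [e1 eE] := gt0_complex e0; move: e0; rewrite eE (ltcR 0) => e0.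
  have := near_infty_natSinv_lt (PosNum e0); apply: filterS => k ke.
  by rewrite distrC; apply: (lt_trans (tP k j)); rewrite ltcR.
have -> : alpha *: basis_vec R 0 + beta *: basis_vec R (- h) =
    \sum_j w j *: (chi_proj j *m basis_vec R (0 : 'Z_n)).
  (* Column 0 of the translation by [v] is e_(-v), which is why the target vertex is [- h]. *)
  have eb v : \sum_j chi j v *: (chi_proj j *m basis_vec R (0 : 'Z_n)) =
      basis_vec R (- v).
    under eq_bigr => j _ do rewrite scalemxAl.
    rewrite -mulmx_suml sum_chi_proj /basis_vec -colE.
    apply/matrixP => a b; rewrite !mxE ord1 eqxx andbT.
    by rewrite -addr_eq0 eq_sym addrC.
  under eq_bigr => j _.
    rewrite wE scalerDl -scalerA -{1}[alpha]mulr1 -(chi0 j).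
    rewrite -[(alpha * _) *: _]scalerA; over.
  by rewrite big_split /= -!scaler_sumr !eb oppr0.
apply: cvg_mx => a b; rewrite summxE.
have -> : (fun k => (transmx (circulant S) (- t k) *m basis_vec R (0 : 'Z_n)) a b) =
    fun k => \sum_j cis (t k * l j) * (chi_proj j *m basis_vec R (0 : 'Z_n)) a b.
  apply/funext => k; rewrite (transmx_circulant _ S0 lE) opprK mulmx_suml summxE.
  by apply: eq_bigr => j _; rewrite -scalemxAl mxE.
have -> : \sum_j (w j *: (chi_proj j *m basis_vec R (0 : 'Z_n))) a b =
    \sum_j w j * (chi_proj j *m basis_vec R (0 : 'Z_n)) a b.
  by apply: eq_bigr => j _; rewrite mxE.
apply: cvg_big => [|j _]; first exact: add_continuous.
by apply: cvgMl.
Qed.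

End Characters.

(** * Eigenvalues, phases and integer relations for n = 2 p^s *)

Theorem theorem4p2 (R : realType) (p s m : nat) (k : 'I_m.+1 -> nat)
    (p_prime : prime p) (p_odd : odd p) (s_gt0 : (0 < s)%N)
    (k_first : k ord0 = 0%N)
    (k_incr : forall i j : 'I_m.+1, (i < j)%N -> (k i < k j)%N)
    (k_last : (k ord_max < s)%N)
    (p_coprime : gcdn p m.+1 = 1%N) :
  PGFR R (circulant (pm_powers (2 * p ^ s)%N p k)).
Proof.
have p1 := prime_gt1 p_prime.
have p3 : (2 < p)%N.
  by rewrite ltn_neqAle p1 andbT; apply: contraTneq p_odd => <-.
set q := (p ^ s)%N; set n := (2 * q)%N.
have q0 : (0 < q)%N by rewrite expn_gt0 ltnW.
have q_odd : odd q by rewrite oddX p_odd orbT.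
have NE : (Zp_trunc n).+2 = n by rewrite Zp_cast // /n; lia.
have k_inj : injective k.
  move=> i j kij; apply/val_inj; have [/k_incr|/k_incr|//] := ltngtP i j;
    by rewrite kij ltnn.
have k_small i : (2 * p ^ k i < n)%N.
  rewrite /n ltn_pmul2l // ltn_exp2l //; apply: leq_ltn_trans k_last.
  have [/k_incr/ltnW//|le_max|e] := ltngtP i (ord_max : 'I_m.+1).
    by have := ltn_ord i; rewrite ltnNge; move: le_max => /= ->.
  by have -> : i = ord_max by apply/val_inj.
have S0 := pm_powers_notin0 p1 k_small.
pose z : R[i] := zeta R n.
(* z^q = exp(pi i), so the j-th character takes the value (-1)^j at [q]. *)
have zq : z ^+ q = -1.
  rewrite /z /zeta -cisX NE /n natrM.
  have -> : q%:R * (2 * pi / (2 * q%:R)) = pi :> R.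
    by field; rewrite pnatr_eq0 -lt0n.
  by rewrite /cis cospi sinpi; apply/eqP; rewrite eq_complex /= oppr0 !eqxx.
pose eta := - z.
have etaq : eta ^+ q = 1.
  by rewrite /eta exprNn zq -signr_odd q_odd expr1 mulrNN mulr1.
pose l (j : 'Z_n) : R :=
  \sum_i 2 * cos ((j * p ^ k i)%N%:R * (2 * pi / (Zp_trunc n).+2%:R)).
have lE j : \sum_(v in pm_powers n p k) chi R j v = (l j)%:C%C.
  rewrite sum_pm_powers // rmorph_sum; apply: eq_bigr => i _.
  rewrite chiNr chi_nat /zeta -cisX -cisN; apply/eqP.
  by rewrite eq_complex /= cosN sinN subrr [2 * cos _]mulr_natl mulr2n !eqxx.
pose sg (j : 'Z_n) : int := (-1) ^+ j.
have chi_q j : chi R j q%:R = (sg j)%:~R.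
  by rewrite chi_nat mulnC exprM -/z zq /sg rmorphXn rmorphN1.
pose phi : R := 2 * pi / p%:R.
(* p > 2 puts [phi] below pi, so sin phi, and with it [beta], is nonzero. *)
have phi_bnd : 0 < phi < pi.
  have pi0 := pi_gt0 R.
  have pR : 2 < p%:R :> R by rewrite (ltr_nat _ 2).
  have pR0 : 0 < p%:R :> R by lra.
  have pi2 : 0 < 2 * pi :> R by lra.
  apply/andP; split; first exact: divr_gt0.
  by rewrite ltr_pdivrMr // [2 * pi]mulrC (ltr_pM2l pi0).
pose w (j : 'Z_n) : R[i] := cis ((sg j)%:~R * phi).
pose alpha : R[i] := (cos phi)%:C%C.
pose beta : R[i] := 'i%C * (sin phi)%:C%C.
have wE j : w j = alpha + beta * chi R j q%:R.
  rewrite chi_q /w /sg -signr_odd.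
  case: (odd j); rewrite ?expr1 ?expr0 /cis; apply/eqP; rewrite eq_complex /=.
    by rewrite mulN1r cosN sinN; apply/andP; split; apply/eqP; ring.
  by rewrite mul1r; apply/andP; split; apply/eqP; ring.
have sin0 : sin phi != 0 by rewrite gt_eqF // sin_gt0_pi.
exists 0, (- q%:R); split.
  rewrite eq_sym oppr_eq0; apply/eqP => /(congr1 (@nat_of_ord _)).
  rewrite val_Zp_nat; last by rewrite /n; lia.
  by rewrite modn_small /n /=; lia.
apply: (PGFR_between_circulant S0 lE wE).
- rewrite mulf_neq0 // eq_complex /= ?oner_eq0 ?andbF //.
  by rewrite negb_and sin0.
- rewrite !normc_def /= -!rmorphXn -rmorphD /= !sqr_sqrtr ?addr_ge0 ?sqr_ge0 //.
  apply/eqP; rewrite eq_complex /= eqxx andbT -[X in _ == X](cos2Dsin2 phi).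
  by apply/eqP; ring.
move=> e e0.
(* [None] is an extra index of frequency 0 and phase 1, the base point required by [kronecker]. *)
pose theta (x : option 'Z_n) : R := oapp l 0 x.
pose sgo (x : option 'Z_n) : int := oapp sg 0 x.
pose wo x : R[i] := cis ((sgo x)%:~R * phi).
(* As eta^q = 1, a factor q - 1 in the exponent stands for the inverse power and keeps [P x] in
   Z[X]; [sg j] compensates the sign in eta = -z. *)
pose P (x : option 'Z_n) : {poly int} := oapp (fun j =>
  sg j *: \sum_i ('X^(j * p ^ k i) + 'X^(j * p ^ k i * q.-1))) 0 x.
have P1 x : (P x).[1] = sgo x * (2 * m.+1)%N%:Z.
  case: x => [j|] /=; last by rewrite horner0 mul0r.
  rewrite hornerZ horner_sum; congr (_ * _).
  under eq_bigr => i _ do rewrite hornerD !hornerXn !expr1n.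
  by rewrite sumr_const card_ord -mulr_natr -[RHS]natz natrM.
have Peta x : (map_poly intr (P x)).[eta] = (theta x)%:C%C.
  case: x => [j|] /=; last by rewrite rmorph0 horner0.
  rewrite map_polyZ rmorph_sum /= hornerZ horner_sum mulr_sumr -lE.
  rewrite sum_pm_powers //; apply: eq_bigr => i _.
  rewrite rmorphD /= !map_polyXn hornerD !hornerXn mulrDr chiNr chi_nat -/z.
  have etaE : eta ^+ (j * p ^ k i) = (sg j)%:~R * z ^+ (j * p ^ k i).
    rewrite /eta exprNn /sg rmorphXn rmorphN1; congr (_ * _).
    by rewrite -signr_odd oddM oddX p_odd orbT andbT signr_odd.
  have sg2 : (sg j)%:~R * (sg j)%:~R = 1 :> R[i].
    by rewrite -intrM /sg -expr2 sqrr_sign.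
  have etaV : eta ^+ (j * p ^ k i * q.-1) = (eta ^+ (j * p ^ k i))^-1.
    have en0 : eta ^+ (j * p ^ k i) != 0.
      by rewrite expf_neq0 // oppr_eq0 cis_neq0.
    apply: (mulIf en0); rewrite mulVf // -exprD -mulnSr prednK //.
    by rewrite mulnC exprM etaq expr1n.
  have sgV : ((sg j)%:~R : R[i])^-1 = (sg j)%:~R.
    have sg0 : (sg j)%:~R != 0 :> R[i] by rewrite intr_eq0 signr_eq0.
    by apply: (mulIf sg0); rewrite mulVf.
  by rewrite etaV etaE invfM sgV !mulrA sg2 !mul1r.
have [||||t tP] := @kronecker R _ theta wo None _ _ _ _ e e0.
- by [].
- by rewrite /wo mul0r cis0.
- by move=> x; rewrite norm_cis.
- move=> r f g fg.
  pose D := \sum_i sgo (f i) - \sum_i sgo (g i).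
  have pD : (p %| D)%Z.
    (* Equal frequency sums make [F] vanish at [eta], while its value at 1 is 2 (m + 1) D. *)
    pose F := \sum_i P (f i) - \sum_i P (g i).
    have F1 : F.[1] = D * (2 * m.+1)%N%:Z.
      rewrite hornerD hornerN !horner_sum mulrBl !mulr_suml.
      by congr (_ - _); apply: eq_bigr => i _; rewrite P1.
    have F0 : (map_poly intr F).[eta] = 0.
      rewrite rmorphB !rmorph_sum /= hornerD hornerN !horner_sum.
      under eq_bigr => i _ do rewrite Peta.
      under [X in _ - X]eq_bigr => i _ do rewrite Peta.
      by rewrite -!rmorph_sum fg subrr.
    have := dvd_horner1_of_root_unity p_prime etaq F0.
    (* [p] is odd and coprime to [m.+1], so it must divide [D]. *)
    rewrite F1 Gauss_dvdzl // coprimezE /= coprimeMr /coprime p_coprime eqxx.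
    by rewrite andbT -/(coprime p 2) coprimen2.
  (* The two products of phases differ by the factor cis (D phi), which is 1. *)
  rewrite -!cis_sum -!mulr_suml -!rmorph_sum /=.
  rewrite -[in LHS](subrK (\sum_i sgo (g i)) (\sum_i sgo (f i))) -/D.
  by rewrite rmorphD mulrDl cisD cis_dvd ?mul1r // ltnW.
by exists t => j; apply: (tP (Some j)).
Qed.
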